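(* Let $n,r\in\mathbb{N}$ with $2<r<n$. Let $A$ be a set of $r$-element subsets of $\{1,\dots,n\}$, let $B$ be a set of partitions of $\{1,\dots,n\}$ each having exactly $r$ classes, and let $$S(A,B)=\langle\{\alpha\in T_n:\ \mathrm{im}\,\alpha\in A,\ \ker\alpha\in B\}\rangle\le T_n .$$ Then $$\mathrm{rank}(S(A,B))=\begin{cases}\max(v_+(A),v_+(B))+v_0(A\cup B) & \text{if } \mathcal{MD}(A\cup B)\ge 2,\\ \max(v_+(A),v_+(B))+v_0(A\cup B)+1 & \text{if } \mathcal{MD}(A\cup B)=1,\\ |A|\,|B|\,r! & \text{if } \mathcal{MD}(A\cup B)=0,\end{cases}$$ where $v_+$, $v_0$ and $\mathcal{MD}(A\cup B)$ refer to the graph $\Gamma(A,B)$.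
   Context: $T_n$ is the full transformation monoid on $\{1,\dots,n\}$ (all maps from the set to itself under composition). For $\alpha\in T_n$, $\mathrm{im}\,\alpha$ is its image and $\ker\alpha$ is the partition of $\{1,\dots,n\}$ into the non-empty fibres of $\alpha$. $\langle X\rangle$ is the subsemigroup generated by $X$, and $\mathrm{rank}(S)$ is the least cardinality of a generating set of the semigroup $S$. $\Gamma(A,B)$ is the bipartite graph with vertex set $A\cup B$ (disjoint union) in which $a\in A$ is adjacent to $b\in B$ if and only if $a$ is a transversal of $b$ (i.e. $a$ contains exactly one element of each class of $b$). With $d(x)$ denoting the degree of the vertex $x$ in $\Gamma(A,B)$, for a set $X$ of vertices: $v_0(X)=|\{x\in X:d(x)=0\}|$ and $v_+(X)=|\{x\in X:d(x)>0\}|$. $\mathcal{MD}(A\cup B)$ is the maximum degree of a vertex of $\Gamma(A,B)$. *)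

(* Defs.v *)
From mathcomp Require Import all_boot.

Set Implicit Arguments.
Unset Strict Implicit.
Unset Printing Implicit Defensive.

(* The full transformation monoid; the points are 0, ..., n - 1. *)
Definition transf (n : nat) : finType := {ffun 'I_n -> 'I_n}.

Definition transf_comp n (f g : transf n) : transf n := [ffun x => g (f x)].

Definition transf_im n (f : transf n) : {set 'I_n} := [set f x | x in [set: 'I_n]].

Definition transf_ker n (f : transf n) : {set {set 'I_n}} :=
  preim_partition f [set: 'I_n].

(* Semigroups may be empty. *)
Definition subsemigroup n (S : {set transf n}) : bool :=
  [forall f in S, forall g in S, transf_comp f g \in S].

Definition semigroup_gen n (X : {set transf n}) : {set transf n} :=
  \bigcap_(S : {set transf n} | subsemigroup S && (X \subset S)) S.

(* Meaningful for a subsemigroup S, since S then generates itself. *)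
Definition semigroup_rank n (S : {set transf n}) : nat :=
  #|[arg min_(X < S | semigroup_gen X == S) #|X|]|.

Definition SAB n (A : {set {set 'I_n}}) (B : {set {set {set 'I_n}}}) :
    {set transf n} :=
  semigroup_gen [set f : transf n | transf_im f \in A & transf_ker f \in B].

Section TransversalGraph.
Variables (n : nat) (A : {set {set 'I_n}}) (B : {set {set {set 'I_n}}}).

Definition vertex : finType := ({set 'I_n} + {set {set 'I_n}})%type.

Definition vertA : {set vertex} := [set inl a | a in A].
Definition vertB : {set vertex} := [set inr b | b in B].
Definition vertAB : {set vertex} := vertA :|: vertB.

Definition adj (x y : vertex) : bool :=
  match x, y with
  | inl a, inr b | inr b, inl a =>
      [&& a \in A, b \in B & is_transversal a b [set: 'I_n]]
  | _, _ => false
  end.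

Definition deg (x : vertex) : nat := #|[set y in vertAB | adj x y]|.

Definition v0 (X : {set vertex}) : nat := #|[set x in X | deg x == 0]|.
Definition vplus (X : {set vertex}) : nat := #|[set x in X | 0 < deg x]|.

Definition max_deg : nat := \max_(x in vertAB) deg x.

End TransversalGraph.

(* Main.v *)
Require Import Defs.
From mathcomp Require Import all_boot fingroup perm ssralg zmodp.

(* Coordinates on the images and on the kernels turn the maps of rank r in
   S(A, B) into triples (b, g, a) with g in S_r, multiplied as in a Rees matrix
   semigroup over the graph: an arrow from the kernel b to the image a can be
   followed by an arrow from b' exactly when a is a transversal of b'.  A product
   of rank r has factors of rank r, so the rank of S(A, B) is the least number of
   arrows whose walks spell all the triples.

   Lower bound: since walks get stuck at vertices of degree 0, every kernel needs
   an outgoing arrow to an image of positive degree, and every image an incoming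
   one from a kernel of positive degree.  If the graph is a matching and no
   further arrow is used, walks are deterministic, so closed walks commute,
   whereas S_r is not abelian.

   Upper bound: arrows forming a cycle through a matching that dominates all
   vertices of positive degree, together with arrows covering the remaining
   vertices, are strongly connected.  Two of their labels can be chosen so that
   two closed walks at a vertex spell two generators of S_r. *)

Set Implicit Arguments.
Unset Strict Implicit.
Unset Printing Implicit Defensive.

(** * Walks in a Rees matrix semigroup *)

Section ReesMatrix.

Variables (TA TB : finType) (G : finGroupType).
Variables (E : TA -> TB -> bool) (p : TA -> TB -> G).
Variables (A : {set TA}) (B : {set TB}).

Local Open Scope group_scope.

Implicit Types (X Y : {set TB * G * TA}) (a u : TA) (b v : TB) (g h w : G).
Implicit Types (M : {set TA * TB}) (e : TA * TB) (s : seq (TA * TB)).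

(** An arrow [(b, g, a)] leads from [b] to [a], and an edge of [E] leads on to the next source,
    contributing the sandwich entry [p a b']. The length is recorded so that walks of equal length
    can be compared. *)
Inductive walk X : nat -> TB -> G -> TA -> Prop :=
| walk1 b g a : (b, g, a) \in X -> walk X 1 b g a
| walkS l b g a b' h a' : (b, g, a) \in X -> E a b' -> walk X l b' h a' ->
    walk X l.+1 b (g * p a b' * h) a'.

Definition reach X b g a := exists l, walk X l b g a.

Definition arrows : {set TB * G * TA} := [set t | (t.1.1 \in B) && (t.2 \in A)].

Definition generates X :=
  X \subset arrows /\ forall b g a, b \in B -> a \in A -> reach X b g a.

Definition Apos := [set a in A | [exists b in B, E a b]].
Definition Bpos := [set b in B | [exists a in A, E a b]].

Lemma AposP a : reflect (a \in A /\ exists2 b, b \in B & E a b) (a \in Apos).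
Proof.
rewrite inE; apply: (iffP andP) => -[Aa]; first by move/exists_inP.
by move=> Ea; split=> //; apply/exists_inP.
Qed.

Lemma BposP b : reflect (b \in B /\ exists2 a, a \in A & E a b) (b \in Bpos).
Proof.
rewrite inE; apply: (iffP andP) => -[Bb]; first by move/exists_inP.
by move=> Eb; split=> //; apply/exists_inP.
Qed.

Lemma sub_walk X Y l b g a : X \subset Y -> walk X l b g a -> walk Y l b g a.
Proof.
move=> /subsetP sXY; elim=> [{}b {}g {}a /sXY | {}l {}b {}g {}a b' h a' /sXY ].
  exact: walk1.
by move=> Yt Eab _ wh; apply: walkS.
Qed.

Lemma sub_reach X Y b g a : X \subset Y -> reach X b g a -> reach Y b g a.
Proof. by move=> sXY [l w]; exists l; apply: sub_walk w. Qed.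

Lemma walk_cat X l l' b g a b' h a' :
  walk X l b g a -> E a b' -> walk X l' b' h a' ->
  walk X (l + l') b (g * p a b' * h) a'.
Proof.
elim=> [{}b {}g {}a Xt Eab wh|{}l {}b {}g {}a b1 h1 a1 Xt Eab w1 IH Ea1 wh].
  by rewrite add1n; apply: walkS.
by have := walkS Xt Eab (IH Ea1 wh); rewrite addSn !mulgA.
Qed.

Lemma reach_cat X b g a b' h a' :
  reach X b g a -> E a b' -> reach X b' h a' ->
  reach X b (g * p a b' * h) a'.
Proof. by move=> [l w] Eab [l' w']; exists (l + l')%N; apply: walk_cat. Qed.

Lemma walk_arrows X l b g a :
  X \subset arrows -> walk X l b g a -> (b \in B) && (a \in A).
Proof.
move=> /subsetP sX; elim=> [{}b {}g {}a /sX | {}l {}b {}g {}a b' h a' /sX ].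
  by rewrite inE.
by rewrite inE => /andP[/= -> _] _ _ /andP[_ ->].
Qed.

(** * Lower bounds for generating sets *)

(** The first arrow of a walk from [b] to [a] either ends at [a] or is followed by an edge; in both
    cases its target has positive degree. *)
Lemma first_arrow X b a :
  generates X -> b \in B -> a \in Apos ->
  exists2 t, t \in [set t in X | t.2 \in Apos] & t.1.1 = b.
Proof.
move=> [sX genX] Bb Aa; have [Aa' _] := AposP _ Aa.
have [l w] := genX b 1 a Bb Aa'; move: Aa.
case: w => [{}b0 {}g0 {}a0 Xt Aa0 | {}l {}b0 {}g {}a0 b' h a' Xt Eab wb' _].
  by exists (b0, g0, a0); rewrite // inE Xt.
exists (b0, g, a0); rewrite // inE Xt /=; apply/AposP; split.
  by have := subsetP sX _ Xt; rewrite inE => /andP[].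
by exists b' => //; have /andP[] := walk_arrows sX wb'.
Qed.

(** Dual to [first_arrow]: along the walk every later source is entered by an edge, so it has
    positive degree. *)
Lemma last_arrow X a b :
  generates X -> a \in A -> b \in Bpos ->
  exists2 t, t \in [set t in X | t.1.1 \in Bpos] & t.2 = a.
Proof.
move=> [sX genX] Aa Bb; have [Bb' _] := BposP _ Bb.
have [l w] := genX b 1 a Bb' Aa; move: Bb; move: 1 => g in w *.
elim: w => [{}b0 {}g0 {}a0 Xt Bb0 | {}l {}b0 {}g0 {}a0 b' h a' Xt Eab wb' IH _].
  by exists (b0, g0, a0); rewrite // inE Xt.
apply: IH; apply/BposP; split; first by have /andP[] := walk_arrows sX wb'.
by exists a0 => //; have := subsetP sX _ Xt; rewrite inE => /andP[].
Qed.

Lemma leq_card_onto (T1 T2 : finType) (f : T1 -> T2) (D : {set T1}) (C : {set T2}) :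
  (forall y, y \in C -> exists2 x, x \in D & f x = y) -> #|C| <= #|D|.
Proof.
move=> onto; apply: leq_trans (leq_imset_card f D).
by apply/subset_leq_card/subsetP => y /onto [x Dx <-]; apply: imset_f.
Qed.

(** The arrows that the graph allows to be extended at both ends. *)
Definition core X := [set t in X | (t.1.1 \in Bpos) && (t.2 \in Apos)].

Lemma in_core X t :
  (t \in core X) = [&& t \in X, t.1.1 \in Bpos & t.2 \in Apos].
Proof. exact: in_set. Qed.

Lemma card_core_geB X : generates X -> Apos != set0 -> #|Bpos| <= #|core X|.
Proof.
move=> gX /set0Pn[a Aa]; apply: (leq_card_onto (f := fun t => t.1.1)) => b Bb.
have [Bb' _] := BposP _ Bb; have [t] := first_arrow gX Bb' Aa.
by rewrite inE => /andP[Xt At] bt; exists t => //; rewrite inE Xt bt Bb.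
Qed.

Lemma card_core_geA X : generates X -> Bpos != set0 -> #|Apos| <= #|core X|.
Proof.
move=> gX /set0Pn[b Bb]; apply: (leq_card_onto (f := fun t => t.2)) => a Aa.
have [Aa' _] := AposP _ Aa; have [t] := last_arrow gX Aa' Bb.
by rewrite inE => /andP[Xt At] bt; exists t => //; rewrite inE Xt bt Aa At.
Qed.

(** An isolated image is entered from a kernel of positive degree, and an isolated kernel is left
    towards an image of positive degree. These arrows form two classes, disjoint from each other and
    from the core. *)
Lemma card_gen_ge X : generates X -> Apos != set0 -> Bpos != set0 ->
  #|core X| + (#|A :\: Apos| + #|B :\: Bpos|) <= #|X|.
Proof.
move=> gX /set0Pn[a0 Aa0] /set0Pn[b0 Bb0].
pose XA := [set t in X | (t.1.1 \in Bpos) && (t.2 \notin Apos)].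
pose XB := [set t in X | (t.1.1 \notin Bpos) && (t.2 \in Apos)].
have leA : #|A :\: Apos| <= #|XA|.
  apply: (leq_card_onto (f := fun t => t.2)) => a /setDP[Aa Aa'].
  have [t] := last_arrow gX Aa Bb0.
  by rewrite inE => /andP[Xt At] bt; exists t => //; rewrite inE Xt bt Aa' At.
have leB : #|B :\: Bpos| <= #|XB|.
  apply: (leq_card_onto (f := fun t => t.1.1)) => b /setDP[Bb Bb'].
  have [t] := first_arrow gX Bb Aa0.
  by rewrite inE => /andP[Xt At] bt; exists t => //; rewrite inE Xt bt Bb' At.
have dAB : #|XA :|: XB| = #|XA| + #|XB|.
  rewrite cardsU; case: (set_0Vmem (XA :&: XB)) => [->|[t]].
    by rewrite cards0 subn0.
  by rewrite !inE => /andP[/and3P[_ -> _] /and3P[]].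
have dC : #|core X :|: (XA :|: XB)| = #|core X| + #|XA :|: XB|.
  rewrite cardsU; case: (set_0Vmem (core X :&: (XA :|: XB))) => [->|[t]].
    by rewrite cards0 subn0.
  case/setIP=> /setIdP[_ /andP[b1 a1]] /setUP[]/setIdP[_ /andP[]].
    by rewrite a1.
  by rewrite b1.
apply: leq_trans (leq_add (leqnn _) (leq_add leA leB)) _.
rewrite -dAB -dC; apply: subset_leq_card.
by rewrite !subUset; apply/and3P; split; apply/subsetP=> t; rewrite inE => /andP[].
Qed.

(** Without edges every walk is a single arrow. *)
Lemma gen_no_edge X :
  (forall a b, a \in A -> b \in B -> ~~ E a b) -> generates X -> X = arrows.
Proof.
move=> noE [sX gX]; apply/eqP; rewrite eqEsubset sX /=.
apply/subsetP=> -[[b g] a]; rewrite inE => /andP[/= Bb Aa].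
have [l w] := gX b g a Bb Aa.
case: w => // {}l {}b0 {}g0 {}a0 b' h a' Xt Eab wb'.
have /andP[Bb' _] := walk_arrows sX wb'.
have := subsetP sX _ Xt; rewrite inE => /andP[_ /= Aa0].
by rewrite (negPf (noE _ _ Aa0 Bb')) in Eab.
Qed.

Lemma gen_arrows : generates arrows.
Proof. by split=> // b g a Bb Aa; exists 1%N; apply: walk1; rewrite inE Bb. Qed.

Lemma card_arrows : #|arrows| = (#|A| * #|B| * #|G|)%N.
Proof.
have -> : arrows = setX (setX B setT) A.
  by apply/setP=> -[[b g] a]; rewrite !inE /= andbT.
by rewrite !cardsX cardsT mulnC mulnA.
Qed.

Lemma walk_inv X l b g a : walk X l b g a ->
  (l = 1%N /\ (b, g, a) \in X) \/
  exists l' g' a' b' h, [/\ l = l'.+1, g = g' * p a' b' * h, (b, g', a') \in X,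
    E a' b' & walk X l' b' h a].
Proof.
case=> [{}b {}g {}a Xt | l' {}b g' a' b' h {}a Xt Eab w]; first by left.
by right; exists l', g', a', b', h.
Qed.

Lemma walk_gt0 X l b g a : walk X l b g a -> 0 < l.
Proof. by case. Qed.

(** Every arrow met lies in the core, so its source determines it; its target then determines the
    next source by the uniqueness of neighbours. *)
Lemma walk_deterministic X l b g a g' a' :
  {in A & B &, forall a b b', E a b -> E a b' -> b = b'} ->
  X \subset arrows ->
  {in core X &, injective (fun t => t.1.1)} ->
  b \in Bpos -> a \in Apos -> a' \in Apos ->
  walk X l b g a -> walk X l b g' a' -> g = g' /\ a = a'.
Proof.
move=> funE sX injX.
have XA t : t \in X -> t.2 \in A by move/(subsetP sX); rewrite inE => /andP[].
elim: l b g g' => [|l IH] b g g' Bb Aa Aa'; first by move/walk_gt0.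
move=> /walk_inv w1 /walk_inv w2.
case: w1 w2 => [[[l0] Xt]|[l1 [g1 [a1 [b1 [h1 [[<-] -> X1 E1 w1]]]]]]].
  case=> [[_ Xt']|[l2 [g2 [a2 [b2 [h2 [[<-] _ _ _ w2]]]]]]]; last first.
    by have := walk_gt0 w2; rewrite l0.
  have := injX (b, g, a) (b, g', a'); rewrite !in_core Xt Xt' /=.
  by rewrite Bb Aa Aa' => /(_ isT isT erefl) [].
case=> [[[l0] _]|[l2 [g2 [a2 [b2 [h2 [[<-] -> X2 E2 w2]]]]]]].
  by have := walk_gt0 w1; rewrite l0.
have /andP[Bb1 _] := walk_arrows sX w1; have /andP[Bb2 _] := walk_arrows sX w2.
have Aa1 : a1 \in Apos by apply/AposP; split; [apply: XA X1 | exists b1].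
have Aa2 : a2 \in Apos by apply/AposP; split; [apply: XA X2 | exists b2].
have := injX (b, g1, a1) (b, g2, a2); rewrite !in_core X1 X2 /=.
rewrite Bb Aa1 Aa2 => /(_ isT isT erefl) [? ?]; subst g2 a2.
have ? : b2 = b1 by apply: (funE a1) => //; apply: XA X1.
subst b2; have Bb1' : b1 \in Bpos.
  by apply/BposP; split=> //; exists a1 => //; apply: XA X1.
by have [-> ->] := IH b1 h1 h2 Bb1' Aa Aa' w1 w2.
Qed.

(* Two closed walks at the same vertex commute, since either concatenation is
   the unique walk of its length: the vertex group is then abelian. *)
Lemma card_core_gtB X :
  generates X ->
  {in A & B &, forall a b b', E a b -> E a b' -> b = b'} ->
  Apos != set0 -> (exists g h : G, g * h != h * g) -> #|Bpos| < #|core X|.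
Proof.
move=> gX funE nA [x [y /eqP nxy]]; rewrite ltn_neqAle card_core_geB // andbT.
apply/eqP=> cB; case/set0Pn: (nA) => a Aa; have [Aa1 [b Bb Eab]] := AposP _ Aa.
have [sX genX] := gX.
(* The sources of core arrows cover [Bpos]; equality of the cardinalities makes the source map
   injective. *)
have injX : {in core X &, injective (fun t : TB * G * TA => t.1.1)}.
  apply/imset_injP; rewrite eqn_leq leq_imset_card -cB subset_leq_card //.
  apply/subsetP=> v Bv; have [Bv' _] := BposP _ Bv.
  have [t /setIdP[Xt At] tv] := first_arrow gX Bv' Aa.
  by apply/imsetP; exists t; rewrite // in_core Xt At tv Bv.
have Bb' : b \in Bpos by apply/BposP; split=> //; exists a.
(* The factors [q^-1] cancel the edge entry: the two concatenations spell [x * y * q^-1] and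
   [y * x * q^-1] with the same length. *)
pose q := p a b; have [l w] := genX b (x * q^-1) a Bb Aa1.
have [l' w'] := genX b (y * q^-1) a Bb Aa1.
have w1 := walk_cat w Eab w'; have := walk_cat w' Eab w; rewrite addnC => w2.
have [+ _] := walk_deterministic funE sX injX Bb' Aa Aa w1 w2.
by rewrite -/q !mulgKV !mulgA => /mulIg.
Qed.

(** * Generating sets built on a cycle *)

(** In a finite group the unit is a positive power of [x], so closure under products suffices. *)
Lemma generated_mul_ind (P : G -> Prop) (x y : G) :
  P x -> P y -> (forall g h, P g -> P h -> P (g * h)) ->
  forall g, g \in <<[set x; y]>> -> P g.
Proof.
move=> Px Py PM g /gen_prodgP[n [c cP ->]].
have P1 : P 1.
  have PX k : P (x ^+ k.+1) by elim: k => // k IH; rewrite expgS; apply: PM.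
  by rewrite -(expg_order x) -(prednK (order_gt0 x)).
by apply: big_ind => // i _; have := cP i; rewrite !inE => /orP[]/eqP->.
Qed.

(* [w] is the label of a walk from [b] to [b'] that ends with an edge of the
   graph, hence can be prepended to any walk leaving [b']. *)
Definition prefix_reach X b w b' := forall Y, X \subset Y ->
  forall g a, reach Y b' g a -> reach Y b (w * g) a.

Lemma sub_prefix_reach X Y b w b' :
  X \subset Y -> prefix_reach X b w b' -> prefix_reach Y b w b'.
Proof. by move=> sXY pX Z sYZ; apply/pX/(subset_trans sXY). Qed.

Lemma prefix_reach_refl X b : prefix_reach X b 1 b.
Proof. by move=> Y _ g a; rewrite mul1g. Qed.

Lemma reach_prefix X b g a b' :
  reach X b g a -> E a b' -> prefix_reach X b (g * p a b') b'.
Proof.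
by move=> r Eab Y sXY h a' r'; apply: reach_cat r'; first exact: sub_reach r.
Qed.

Lemma prefix_reach_trans X b w b' w' b'' :
  prefix_reach X b w b' -> prefix_reach X b' w' b'' ->
  prefix_reach X b (w * w') b''.
Proof. by move=> r r' Y sXY g a ra; rewrite -mulgA; apply/r/r'. Qed.

Lemma reach1 X b g a : (b, g, a) \in X -> reach X b g a.
Proof. by move=> Xt; exists 1%N; apply: walk1. Qed.

(** Arrows with trivial label lead from the kernel end of each edge to the image end of the next
    one, so edges and arrows alternate along a path. *)
Fixpoint chain e s : seq (TB * G * TA) :=
  if s is e' :: s' then (e.2, 1, e'.1) :: chain e' s' else [::].

Lemma size_chain e s : size (chain e s) = size s.
Proof. by elim: s e => //= e' s IH e; rewrite IH. Qed.

Lemma chain_from e s e' : all (fun e => E e.1 e.2) s -> e' \in e :: s ->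
  exists w, prefix_reach [set:: chain e s] e.2 w e'.2.
Proof.
elim: s e => [|e1 s IH] e Es; rewrite in_cons => /predU1P[->|].
- by exists 1; apply: prefix_reach_refl.
- by [].
- by exists 1; apply: prefix_reach_refl.
move=> se'; case/andP: Es => Ee1 /IH/(_ se')[w pw].
exists (1 * p e1.1 e1.2 * w); apply: prefix_reach_trans.
  by apply: reach_prefix Ee1; apply: reach1; rewrite inE mem_head.
by apply: sub_prefix_reach pw; apply/subsetP=> t; rewrite !inE => ->; rewrite orbT.
Qed.

Lemma chain_to e s e' : all (fun e => E e.1 e.2) s -> e' \in e :: s ->
  exists w, prefix_reach [set:: chain e s] e'.2 w (last e s).2.
Proof.
elim: s e => [|e1 s IH] e Es; rewrite in_cons => /predU1P[->|].
- by exists 1; apply: prefix_reach_refl.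
- by [].
- exact: (chain_from Es (mem_last _ _)).
move=> se'; case/andP: Es => Ee1 /IH/(_ se')[w pw]; exists w.
by apply: sub_prefix_reach pw; apply/subsetP=> t; rewrite !inE => ->; rewrite orbT.
Qed.

(** The walk stops before crossing [e']. The head [e] is left out, as the chain need not have an
    arrow into its image end. *)
Lemma chain_reach e s e' : all (fun e => E e.1 e.2) s -> e' \in s ->
  exists w, reach [set:: chain e s] e.2 w e'.1.
Proof.
elim: s e => [|e1 s IH] e //= /andP[Ee1 Es]; rewrite inE => /predU1P[->|se'].
  by exists 1; apply: reach1; rewrite inE mem_head.
have sC : [set:: chain e1 s] \subset [set:: (e.2, 1, e1.1) :: chain e1 s].
  by apply/subsetP=> t; rewrite !inE => ->; rewrite orbT.
have [w rw] := IH e1 Es se'; exists (1 * p e1.1 e1.2 * w).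
apply: (reach_cat _ Ee1 (sub_reach sC rw)).
by apply: reach1; rewrite inE mem_head.
Qed.

Lemma chain_arrows e s t : all (fun e => (e.1 \in A) && (e.2 \in B)) (e :: s) ->
  t \in chain e s -> t \in arrows.
Proof.
elim: s e => [|e1 s IH] e //= /and3P[/andP[_ Be] ABe1 ABs].
rewrite inE => /predU1P[->|]; last by apply: IH; rewrite /= ABe1.
by rewrite inE Be; case/andP: ABe1.
Qed.

Lemma card_set_seq_le (T : finType) (ts : seq T) : #|[set:: ts]| <= size ts.
Proof. by rewrite cardsE; apply: card_size. Qed.

(* The chain through a matching is closed into a cycle by an arrow whose label
   makes the cycle spell [x]; the first of the [N] additional arrows, at index
   0, is labelled so that a closed walk through it spells [y]. *)
Lemma generating_set x y e0 s (vs bs : seq TB) (us as0 : seq TA) (N : nat) :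
    [set: G] \subset <<[set x; y]>> ->
    all (fun e => [&& e.1 \in A, e.2 \in B & E e.1 e.2]) (e0 :: s) ->
    (forall v, v \in vs -> v \in B /\ exists2 e, e \in e0 :: s & E e.1 v) ->
    (forall u, u \in us -> u \in A /\ exists2 e, e \in e0 :: s & E u e.2) ->
    {subset bs <= B} -> {subset as0 <= A} ->
    (forall b, b \in B -> [|| b \in map snd (e0 :: s), b \in vs | b \in bs]) ->
    (forall a, a \in A -> [|| a \in map fst (e0 :: s), a \in us | a \in as0]) ->
    0 < N -> size vs <= N -> size us <= N ->
  exists2 X, generates X & #|X| <= (size s).+1 + N + (size as0 + size bs).
Proof.
move=> genG sE vsP usP bsB asA coverB coverA N0 leV leU.
have [Es0 Es] : E e0.1 e0.2 /\ all (fun e => E e.1 e.2) s.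
  case/andP: sE => /and3P[_ _ ->] sE; split=> //.
  by apply: sub_all sE => e /and3P[].
set a1 := e0.1; set b1 := e0.2; pose q := p a1 b1.
pose X0 := [set:: chain e0 s].
have [w0 pw0] := chain_from (e := e0) Es (mem_last _ _).
(* The way from [b1] to the last edge spells [w0], so closing the chain by [c] spells
   [w0 * c = x * q^-1]; crossing the edge from [a1] to [b1] supplies [q]. *)
pose c := w0^-1 * x * q^-1; pose t1 := ((last e0 s).2, c, a1).
pose X1 := t1 |: X0.
have sX01 : X0 \subset X1 by apply: subsetUr.
have rt1 : reach X1 (last e0 s).2 c a1 by apply: reach1; rewrite setU11.
have rx : reach X1 b1 (x * q^-1) a1.
  by have := pw0 _ sX01 _ _ rt1; rewrite /c !mulgA mulgV mul1g.
have toa1 e : e \in e0 :: s -> exists w, reach X1 e.2 w a1.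
  move=> se; have [w pw] := chain_to Es se; exists (w * c).
  exact: pw rt1.
have fromb1 e : e \in e0 :: s -> exists w, reach X1 b1 w e.1.
  rewrite inE => /predU1P[->|se]; first by exists (x * q^-1).
  have [w rw] := chain_reach e0 Es se; exists w; exact: sub_reach rw.
(* [isV] describes kernels that can be entered from the cycle, [isU] images from which it can be
   rejoined. *)
pose isV v := v = b1 \/ exists2 e, e \in e0 :: s & E e.1 v.
pose isU u := u = a1 \/ exists2 e, e \in e0 :: s & E u e.2.
have preV v : isV v -> exists w, prefix_reach X1 b1 w v.
  case=> [->|[e se Eev]]; first by exists 1; apply: prefix_reach_refl.
  have [w rw] := fromb1 e se; exists (w * p e.1 v); exact: reach_prefix.
have postU u : isU u -> exists w, forall X b g, X1 \subset X ->
    (b, g, u) \in X -> reach X b (g * w) a1.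
  case=> [->|[e se Eue]].
    by exists 1 => X b g _ Xt; rewrite mulg1; apply: reach1.
  have [w rw] := toa1 e se; exists (p u e.2 * w) => X b g sX Xt.
  by rewrite mulgA; apply: (reach_cat (reach1 Xt) Eue); apply: sub_reach rw.
(* The defaults pad both lists to length [N] with vertices of the cycle, so one additional arrow
   serves a vertex of [vs] and one of [us] at once. *)
pose v_ i := nth b1 vs i; pose u_ i := nth a1 us i.
have isVv i : isV (v_ i).
  rewrite /v_; case: (ltnP i (size vs)) => [/(mem_nth b1)/vsP[_]|/(nth_default b1) ->].
    by right.
  by left.
have isUu i : isU (u_ i).
  rewrite /u_; case: (ltnP i (size us)) => [/(mem_nth a1)/usP[_]|/(nth_default a1) ->].
    by right.
  by left.
have [wv pwv] := preV _ (isVv 0%N); have [wu pwu] := postU _ (isUu 0%N).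
(* Chosen so that [wv * d * wu = y * q^-1]. *)
pose d := wv^-1 * y * q^-1 * wu^-1.
pose extra i := (v_ i, if i == 0%N then d else 1, u_ i).
(* Vertices of [as0] and [bs] get one arrow each, from [b1] and to [a1] respectively. *)
pose ts := map extra (iota 0 N) ++
  ([seq (b1, 1, a) | a <- as0] ++ [seq (b, 1, a1) | b <- bs]).
pose X := X1 :|: [set:: ts].
have sX1 : X1 \subset X by apply: subsetUl.
have Xextra i : i < N -> extra i \in X.
  move=> iN; rewrite inE; apply/orP; right; rewrite inE mem_cat.
  by apply/orP; left; apply: map_f; rewrite mem_iota.
have XA a : a \in as0 -> (b1, 1, a) \in X.
  move=> aP; rewrite inE; apply/orP; right; rewrite inE !mem_cat.
  by apply/orP; right; apply/orP; left; apply/mapP; exists a.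
have XB b : b \in bs -> (b, 1, a1) \in X.
  move=> bP; rewrite inE; apply/orP; right; rewrite inE !mem_cat.
  by apply/orP; right; apply/orP; right; apply/mapP; exists b.
have [Aa1 Bb1] : a1 \in A /\ b1 \in B by case/andP: sE => /and3P[].
(* Since the edge from [a1] to [b1] supplies [q], the elements [g] for which [g * q^-1] is spelled
   from [b1] to [a1] are closed under products. *)
have gen1 g : reach X b1 g a1.
  have : g * q \in <<[set x; y]>> by apply: (subsetP genG).
  rewrite -[in reach _ _ _ _](mulgK q g); move: (g * q) => {}g.
  apply: (generated_mul_ind (P := fun g => reach X b1 (g * q^-1) a1)).
  - exact: sub_reach rx.
  - have := pwv _ sX1 _ _ (pwu X _ _ sX1 (Xextra 0%N N0)).
    by rewrite /d !mulgA mulgV mul1g mulgKV.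
  - by move=> h h' rh rh'; have := reach_cat rh Es0 rh'; rewrite mulgKV mulgA.
exists X; last first.
  rewrite -addnA; apply: leq_trans (leq_card_setU _ _).1 _; apply: leq_add.
    apply: leq_trans (leq_card_setU _ _).1 _; rewrite cards1 add1n ltnS.
    by rewrite -(size_chain e0 s); apply: card_set_seq_le.
  apply: leq_trans (card_set_seq_le _) _.
  by rewrite !size_cat !size_map size_iota.
split=> [|b g a Bb Aa].
  have ABs : all (fun e => (e.1 \in A) && (e.2 \in B)) (e0 :: s).
    by apply: sub_all sE => e /and3P[-> ->].
  have BV i : v_ i \in B.
    rewrite /v_; case: (ltnP i (size vs)) => [/(mem_nth b1)/vsP[]//|].
    by move/(nth_default b1)=> ->.
  have AU i : u_ i \in A.
    rewrite /u_; case: (ltnP i (size us)) => [/(mem_nth a1)/usP[]//|].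
    by move/(nth_default a1)=> ->.
  rewrite !subUset sub1set -andbA; apply/and3P; split.
  - rewrite inE /= Aa1 andbT.
    by have /andP[] := allP ABs _ (mem_last e0 s).
  - by apply/subsetP=> t; rewrite inE => /(chain_arrows ABs).
  apply/subsetP=> t; rewrite inE !mem_cat => /or3P[]/mapP[z zP ->]; rewrite inE /=.
  - by rewrite BV AU.
  - by rewrite Bb1 asA.
  - by rewrite Aa1 bsB.
have [wb rb] : exists w, reach X b w a1.
  case/or3P: (coverB b Bb) => [/mapP[e se ->]|bv|/XB bb].
  - by have [w /(sub_reach sX1) rw] := toa1 e se; exists w.
  - have iN : index b vs < N by apply: leq_trans leV; rewrite index_mem.
    have := Xextra _ iN; rewrite /extra {1}/v_ nth_index // => Xt.
    by have [w pw] := postU _ (isUu (index b vs)); eexists; apply: pw Xt.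
  - by exists 1; apply: reach1.
have [wa ra] : exists w, reach X b1 w a.
  case/or3P: (coverA a Aa) => [/mapP[e se ->]|bv|/XA bb].
  - by have [w /(sub_reach sX1) rw] := fromb1 e se; exists w.
  - have iN : index a us < N by apply: leq_trans leU; rewrite index_mem.
    have := Xextra _ iN; rewrite /extra {1}/u_ nth_index // => /reach1 Xt.
    by have [w pw] := preV _ (isVv (index a us)); eexists; apply: pw sX1 _ _ Xt.
  - by exists 1; apply: reach1.
(* The middle label solves [wb * q * _ * q * wa = g]. *)
have := reach_cat (reach_cat rb Es0 (gen1 ((wb * q)^-1 * g * (q * wa)^-1))) Es0 ra.
by rewrite -/q !mulgA mulgV mul1g -!mulgA mulVg mulg1.
Qed.

(** * Dominating matchings *)

Definition matching M :=
  [forall e in M, [&& e.1 \in A, e.2 \in B & E e.1 e.2]] &&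
  [forall e in M, forall e' in M, (e.1 == e'.1) || (e.2 == e'.2) ==> (e == e')].

Lemma matchingP M : reflect
  ((forall e, e \in M -> [&& e.1 \in A, e.2 \in B & E e.1 e.2]) /\
   {in M &, forall e e', (e.1 == e'.1) || (e.2 == e'.2) -> e = e'}) (matching M).
Proof.
apply: (iffP andP) => -[mE mI]; split.
- exact/forall_inP.
- move=> e e' Me Me' ee'.
  by have /forall_inP/(_ e' Me')/implyP/(_ ee')/eqP := forall_inP mI e Me.
- exact/forall_inP.
- apply/forall_inP=> e Me; apply/forall_inP=> e' Me'.
  by apply/implyP=> ee'; apply/eqP/mI.
Qed.

(** Adjacency is to the opposite ends of [M], which is what walks joining or leaving the cycle
    need. *)
Definition dominating M :=
  (forall a, a \in Apos -> exists2 e, e \in M & E a e.2) /\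
  (forall b, b \in Bpos -> exists2 e, e \in M & E e.1 b).

(** A maximal matching shares an end with every edge, since otherwise that edge could be added.
    Hence each vertex of an edge is matched or adjacent to a matched vertex, and in both cases it is
    dominated. *)
Lemma dominating_matching : exists2 M, matching M & dominating M.
Proof.
have m0 : matching set0 by apply/matchingP; split=> [e|e e']; rewrite inE.
have [M maxM _] := maxset_exists m0.
have [mE mI] := matchingP _ (maxsetp maxM).
have hit a b : a \in A -> b \in B -> E a b ->
    exists2 e, e \in M & (e.1 == a) || (e.2 == b).
  move=> Aa Bb Eab; pose hits e := (e.1 == a) || (e.2 == b).
  case: (boolP [exists e in M, hits e]) => [/exists_inP//|].
  rewrite negb_exists_in => /forall_inP noM.
  have mM' : matching ((a, b) |: M).
    apply/matchingP; split=> [e|e e'].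
      by case/setU1P=> [->|/mE //]; rewrite Aa Bb Eab.
    case/setU1P=> [->|Me] /setU1P[->|Me'] //.
    - by have := noM _ Me'; rewrite /hits /= (eq_sym a) (eq_sym b) => /negPf->.
    - by have := noM _ Me; rewrite /hits /= => /negPf->.
    - exact: mI.
  have abM : (a, b) \in M by rewrite -(maxsetsup maxM mM' (subsetUr _ _)) setU11.
  by have := noM _ abM; rewrite /hits /= eqxx.
exists M; first by apply/matchingP.
split=> [a /AposP[Aa [b Bb Eab]]|b /BposP[Bb [a Aa Eab]]];
  have [e Me /orP[]/eqP he] := hit _ _ Aa Bb Eab; exists e => //; rewrite ?he //.
- by rewrite -he; have /and3P[] := mE _ Me.
- by rewrite -he; have /and3P[] := mE _ Me.
Qed.

Lemma card_matching_fst M : matching M -> #|[set e.1 | e in M]| = #|M|.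
Proof.
move=> /matchingP[_ mI]; apply: card_in_imset => e e' Me Me' ee'.
by apply: mI => //; rewrite ee' eqxx.
Qed.

Lemma card_matching_snd M : matching M -> #|[set e.2 | e in M]| = #|M|.
Proof.
move=> /matchingP[_ mI]; apply: card_in_imset => e e' Me Me' ee'.
by apply: mI => //; rewrite ee' eqxx orbT.
Qed.

Lemma matching_fst_sub M : matching M -> [set e.1 | e in M] \subset Apos.
Proof.
move=> /matchingP[mE _]; apply/subsetP=> _ /imsetP[e /mE/and3P[Aa Bb Eab] ->].
by apply/AposP; split=> //; exists e.2.
Qed.

Lemma matching_snd_sub M : matching M -> [set e.2 | e in M] \subset Bpos.
Proof.
move=> /matchingP[mE _]; apply/subsetP=> _ /imsetP[e /mE/and3P[Aa Bb Eab] ->].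
by apply/BposP; split=> //; exists e.1.
Qed.

(* If a maximal matching is perfect, an edge [(a, b)] outside of it replaces the
   two matching edges at its ends, and still dominates their other ends. *)
Lemma imperfect_dominating_matching :
  (exists a b, [/\ a \in A, b \in B, E a b &
     (exists2 a', a' \in A & E a' b && (a' != a)) \/
     (exists2 b', b' \in B & E a b' && (b' != b))]) ->
  exists M, [/\ matching M, dominating M & #|M| < maxn #|Apos| #|Bpos|].
Proof.
move=> deg2; have [M mM domM] := dominating_matching.
case: (ltnP #|M| (maxn #|Apos| #|Bpos|)) => [|geM]; first by exists M.
(* Here [M] attains the maximum, so it covers all vertices of positive degree on both sides. *)
have [mE mI] := matchingP _ mM.
have fstM : [set e.1 | e in M] = Apos.
  apply/eqP; rewrite eqEcard matching_fst_sub // card_matching_fst //.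
  by apply: leq_trans geM; apply: leq_maxl.
have sndM : [set e.2 | e in M] = Bpos.
  apply/eqP; rewrite eqEcard matching_snd_sub // card_matching_snd //.
  by apply: leq_trans geM; apply: leq_maxr.
(* Of two edges with a common end at most one belongs to [M]. *)
have [a [b [Aa Bb Eab nM]]] :
    exists a b, [/\ a \in A, b \in B, E a b & (a, b) \notin M].
  have [a [b [Aa Bb Eab more]]] := deg2.
  case: (boolP ((a, b) \in M)) => [abM|]; last by exists a, b.
  case: more => [[a' Aa' /andP[Ea' na]]|[b' Bb' /andP[Eb' nb]]].
    exists a', b; split=> //; apply/negP => a'bM; case/eqP: na.
    by have [] : (a', b) = (a, b) by apply: mI; rewrite //= eqxx orbT.
  exists a, b'; split=> //; apply/negP => ab'M; case/eqP: nb.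
  by have [] : (a, b') = (a, b) by apply: mI; rewrite //= eqxx.
have /imsetP[[a1 b1] M1 /= e1] : a \in [set e.1 | e in M].
  by rewrite fstM; apply/AposP; split=> //; exists b.
have /imsetP[[a2 b2] M2 /= e2] : b \in [set e.2 | e in M].
  by rewrite sndM; apply/BposP; split=> //; exists a.
subst a1 b2; pose M' := (a, b) |: (M :\ (a, b1) :\ (a2, b)).
have n12 : (a2, b) != (a, b1) by apply: contraNneq nM => -[<- _].
have oldM e : e \in M -> [\/ e = (a, b1), e = (a2, b) | e \in M'].
  move=> Me; case: (e =P (a, b1)) => [|/eqP n1]; first by constructor 1.
  case: (e =P (a2, b)) => [|/eqP n2]; first by constructor 2.
  by constructor 3; rewrite !inE Me n1 n2 orbT.
have abM' : (a, b) \in M' by rewrite setU11.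
exists M'; split.
- apply/matchingP.
  have offM e : e \in M :\ (a, b1) :\ (a2, b) -> [/\ e \in M, e.1 != a & e.2 != b].
    rewrite !inE => /and3P[ne2 ne1 Me]; split=> //.
      by apply: contraNneq ne1 => ea; apply/eqP/mI; rewrite //= ea eqxx.
    by apply: contraNneq ne2 => ea; apply/eqP/mI; rewrite //= ea eqxx orbT.
  split=> [e|e e'].
    by case/setU1P=> [->|/offM[/mE]//]; rewrite Aa Bb Eab.
  case/setU1P=> [->|/offM[Me na nb]] /setU1P[->|/offM[Me' na' nb']] //.
  - by rewrite /= (eq_sym a) (eq_sym b) (negPf na') (negPf nb').
  - by rewrite /= (negPf na) (negPf nb).
  - exact: mI.
- split=> [a' Aa'|b' Bb'].
    have /imsetP[e Me ea'] : a' \in [set e.1 | e in M] by rewrite fstM.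
    have /and3P[_ _ Ee] := mE _ Me; subst a'.
    case: (oldM _ Me) => [?|?|Me']; last by exists e.
      by subst e; exists (a, b).
    by subst e; exists (a, b).
  have /imsetP[e Me ea'] : b' \in [set e.2 | e in M] by rewrite sndM.
  have /and3P[_ _ Ee] := mE _ Me; subst b'.
  case: (oldM _ Me) => [?|?|Me']; last by exists e.
    by subst e; exists (a, b).
  by subst e; exists (a, b).
have c1 : #|M| = #|M :\ (a, b1)|.+1 by rewrite (cardsD1 (a, b1)) M1.
have c2 : #|M :\ (a, b1)| = #|M :\ (a, b1) :\ (a2, b)|.+1.
  by rewrite (cardsD1 (a2, b)) in_setD1 n12 M2.
have c3 : #|M'| <= #|M :\ (a, b1) :\ (a2, b)|.+1.
  by rewrite cardsU1; case: (_ \notin _).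
have cM : #|M| <= #|Apos|.
  by rewrite -card_matching_fst // subset_leq_card ?matching_fst_sub.
apply: leq_trans (leq_trans _ cM) (leq_maxl _ _).
by rewrite c1 c2.
Qed.

(** The cycle costs one arrow for each edge of [M]. The [N] additional arrows serve unmatched
    kernels and unmatched images simultaneously, whence a maximum and not a sum; each isolated
    vertex costs one arrow. *)
Lemma dominating_generates x y M N :
    [set: G] \subset <<[set x; y]>> -> matching M -> dominating M ->
    M != set0 -> 0 < N -> maxn #|Apos| #|Bpos| <= #|M| + N ->
  exists2 X, generates X &
    #|X| <= #|M| + N + (#|A :\: Apos| + #|B :\: Bpos|).
Proof.
move=> genG mM [domA domB] nM N0 leN; have [mE mI] := matchingP _ mM.
have sMA := matching_fst_sub mM; have sMB := matching_snd_sub mM.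
case eM : (enum M) => [|e0 s].
  by case/set0Pn: nM => e; rewrite -mem_enum eM.
have memM e : (e \in e0 :: s) = (e \in M) by rewrite -eM mem_enum.
have cM : #|M| = (size s).+1 by rewrite cardE eM.
have cA := cardsD Apos [set e.1 | e in M].
have cB := cardsD Bpos [set e.2 | e in M].
rewrite (setIidPr sMA) card_matching_fst // in cA.
rewrite (setIidPr sMB) card_matching_snd // in cB.
have := @generating_set x y e0 s (enum (Bpos :\: [set e.2 | e in M]))
  (enum (B :\: Bpos)) (enum (Apos :\: [set e.1 | e in M])) (enum (A :\: Apos)) N genG.
rewrite -!cardE -cM; apply => //.
- by apply/allP=> e; rewrite memM => /mE.
- move=> v; rewrite mem_enum => /setDP[Bv _]; split; first by case/BposP: Bv.
  by have [e Me Ee] := domB v Bv; exists e; rewrite ?memM.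
- move=> u; rewrite mem_enum => /setDP[Au _]; split; first by case/AposP: Au.
  by have [e Me Ee] := domA u Au; exists e; rewrite ?memM.
- by move=> b; rewrite mem_enum => /setDP[].
- by move=> a; rewrite mem_enum => /setDP[].
- move=> b Bb; rewrite !mem_enum !in_setD Bb andbT.
  case: (boolP (b \in Bpos)); rewrite ?orbT // andbT orbF => _.
  case: imsetP => [[e Me ->]|]; rewrite ?orbT // orbF.
  by apply: map_f; rewrite memM.
- move=> a Aa; rewrite !mem_enum !in_setD Aa andbT.
  case: (boolP (a \in Apos)); rewrite ?orbT // andbT orbF => _.
  case: imsetP => [[e Me ->]|]; rewrite ?orbT // orbF.
  by apply: map_f; rewrite memM.
- by rewrite cB leq_subLR; apply: leq_trans leN; apply: leq_maxr.
- by rewrite cA leq_subLR; apply: leq_trans leN; apply: leq_maxl.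
Qed.

(** * The triples spelled by walks, as a finite set *)

Definition arrow_mul (t t' : TB * G * TA) : TB * G * TA :=
  (t.1.1, t.1.2 * p t.2 t'.1.1 * t'.1.2, t'.2).

Definition step X (t t' : TB * G * TA) :=
  [exists x in X, E t.2 x.1.1 && (t' == arrow_mul t x)].

(* A decidable form of [reach], needed to form subsets of the finite type of maps. *)
Definition walk_closure X := [set t | [exists x in X, connect (step X) x t]].

Lemma walk_closure_reach X b g a : (b, g, a) \in walk_closure X -> reach X b g a.
Proof.
rewrite inE => /exists_inP[x Xx /connectP[ts path_ts last_ts]].
have rx : reach X x.1.1 x.1.2 x.2.
  by apply: reach1; case: x Xx {path_ts last_ts} => [[]].
have : let t := last x ts in reach X t.1.1 t.1.2 t.2.
  elim: ts {Xx last_ts} x rx path_ts => //= t ts IH x rx /andP[/exists_inP[z Xz]].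
  case/andP=> Exz /eqP->; apply: IH; apply: (reach_cat rx Exz).
  by apply: reach1; case: z Xz {Exz} => [[]].
by rewrite -last_ts.
Qed.

Lemma sub_walk_closure X : X \subset walk_closure X.
Proof. by apply/subsetP=> x Xx; rewrite inE; apply/exists_inP; exists x. Qed.

(** Steps extend a triple on the right only, so by associativity the path leading to [t'] can be
    replayed after multiplying by [t] on the left. *)
Lemma walk_closure_mul X t t' :
  t \in walk_closure X -> t' \in walk_closure X -> E t.2 t'.1.1 ->
  arrow_mul t t' \in walk_closure X.
Proof.
rewrite !inE => /exists_inP[z Xz zt] /exists_inP[x Xx /connectP[ts path_ts ->]].
move=> Ett'; apply/exists_inP; exists z => //; apply: (connect_trans zt).
have src : (last x ts).1.1 = x.1.1.
  elim: ts x path_ts {Xx Ett'} => //= t1 ts IH x /andP[/exists_inP[y _]].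
  by case/andP=> _ /eqP->; move/IH ->.
rewrite src in Ett'; have tx : connect (step X) t (arrow_mul t x).
  by apply: connect1; apply/exists_inP; exists x; rewrite // Ett' eqxx.
apply: (connect_trans tx).
elim: ts x path_ts {Xx tx src Ett'} => [|t1 ts IH] x //=.
case/andP=> /exists_inP[y Xy /andP[Exy /eqP->]] /IH; apply: connect_trans.
apply: connect1; apply/exists_inP; exists y; rewrite // Exy.
by apply/eqP; rewrite /arrow_mul /= !mulgA.
Qed.

(** * Least generating sets in the three cases *)

Definition least_gen N :=
  (exists2 X, generates X & #|X| <= N) /\ (forall X, generates X -> N <= #|X|).

Lemma edge_pos a b : a \in A -> b \in B -> E a b -> a \in Apos /\ b \in Bpos.
Proof.
move=> Aa Bb Eab; split; first by apply/AposP; split=> //; exists b.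
by apply/BposP; split=> //; exists a.
Qed.

Lemma dominating_neq0 M a : dominating M -> a \in Apos -> M != set0.
Proof. by move=> [domA _] /domA[e Me _]; apply/set0Pn; exists e. Qed.

Lemma least_gen_path x y :
  [set: G] \subset <<[set x; y]>> ->
  (exists a b, [/\ a \in A, b \in B, E a b &
     (exists2 a', a' \in A & E a' b && (a' != a)) \/
     (exists2 b', b' \in B & E a b' && (b' != b))]) ->
  least_gen (maxn #|Apos| #|Bpos| + (#|A :\: Apos| + #|B :\: Bpos|)).
Proof.
move=> genG deg2; have [a [b [Aa Bb Eab _]]] := deg2.
have [posa posb] := edge_pos Aa Bb Eab; split=> [|X gX].
  have [M [mM domM ltM]] := imperfect_dominating_matching deg2.
  (* The number of additional arrows is positive because [M] misses the maximum. *)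
  have := @dominating_generates x y M (maxn #|Apos| #|Bpos| - #|M|) genG mM domM.
  rewrite subn_gt0 subnKC ?(ltnW ltM) //; apply=> //.
  exact: dominating_neq0 domM posa.
have nA : Apos != set0 by apply/set0Pn; exists a.
have nB : Bpos != set0 by apply/set0Pn; exists b.
apply: leq_trans (card_gen_ge gX nA nB); rewrite leq_add2r geq_max.
by rewrite card_core_geA // card_core_geB.
Qed.

Lemma least_gen_matching x y :
  [set: G] \subset <<[set x; y]>> ->
  (exists g h : G, g * h != h * g) ->
  (exists a b, [/\ a \in A, b \in B & E a b]) ->
  {in A & B &, forall a b b', E a b -> E a b' -> b = b'} ->
  (forall a a' b, a \in A -> a' \in A -> b \in B -> E a b -> E a' b -> a = a') ->
  least_gen (maxn #|Apos| #|Bpos| + (#|A :\: Apos| + #|B :\: Bpos|) + 1).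
Proof.
move=> genG ncG [a [b [Aa Bb Eab]]] funA funB.
have [posa posb] := edge_pos Aa Bb Eab; split=> [|X gX].
  have [M mM domM] := dominating_matching.
  have leM : #|M| <= maxn #|Apos| #|Bpos|.
    apply: leq_trans (leq_maxl _ _).
    by rewrite -card_matching_fst // subset_leq_card ?matching_fst_sub.
  (* The successor keeps the number of additional arrows positive even when [M] attains the
     maximum. *)
  have := @dominating_generates x y M (maxn #|Apos| #|Bpos| - #|M|).+1 genG mM domM.
  rewrite addnS subnKC // addn1 addSn; apply=> //.
  exact: dominating_neq0 domM posa.
have nA : Apos != set0 by apply/set0Pn; exists a.
have nB : Bpos != set0 by apply/set0Pn; exists b.
(* Sending a kernel to its unique neighbour is onto [Apos]. The maximum is thus [#|Bpos|], for which
   the core bound is strict. *)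
have leAB : #|Apos| <= #|Bpos|.
  apply: (leq_card_onto (f := fun b => odflt a [pick a in A | E a b])) => a'.
  case/AposP=> Aa' [b' Bb' Eab'].
  exists b'; first by have [] := edge_pos Aa' Bb' Eab'.
  case: pickP => [a2 /andP[Aa2 Ea2]|/(_ a')]; last by rewrite Aa' Eab'.
  exact: funB Ea2 Eab'.
apply: leq_trans (card_gen_ge gX nA nB); rewrite addn1 -addSn leq_add2r.
by rewrite (maxn_idPr leAB) card_core_gtB.
Qed.

Lemma least_gen_no_edge :
  (forall a b, a \in A -> b \in B -> ~~ E a b) ->
  least_gen (#|A| * #|B| * #|G|).
Proof.
move=> noE; rewrite -card_arrows; split.
  by exists arrows => //; apply: gen_arrows.
by move=> X /(gen_no_edge noE) ->.
Qed.

End ReesMatrix.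

(** * Coordinates on maps of rank r *)

Definition transv n (a : {set 'I_n}) (b : {set {set 'I_n}}) : bool :=
  is_transversal a b [set: 'I_n].

Section Coordinates.

Variables (n r : nat) (x0 : 'I_n) (i0 : 'I_r).
Implicit Types (a : {set 'I_n}) (b : {set {set 'I_n}}).

(** The defaults [x0] here and [i0] in [ker_coord] are not reached when [a] has [r] elements and [b]
    is a partition into [r] classes. *)
Definition img_coord a (i : 'I_r) : 'I_n := nth x0 (enum a) i.

Definition ker_coord b (x : 'I_n) : 'I_r :=
  insubd i0 (index (pblock b x) (enum b)).

Lemma img_coord_in a i : #|a| = r -> img_coord a i \in a.
Proof. by move=> ra; rewrite -mem_enum mem_nth // -cardE ra. Qed.

Lemma img_coord_inj a : #|a| = r -> injective (img_coord a).
Proof.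
move=> ra i j /eqP; rewrite nth_uniq ?enum_uniq -?cardE ?ra ?ltn_ord //.
by move/eqP/val_inj.
Qed.

Lemma img_coord_onto a x : #|a| = r -> x \in a -> exists i, img_coord a i = x.
Proof.
move=> ra ax; have lt : index x (enum a) < r by rewrite -ra cardE index_mem mem_enum.
by exists (Ordinal lt); rewrite /img_coord nth_index ?mem_enum.
Qed.

Section Partition.

Variables (b : {set {set 'I_n}}).
Hypotheses (pb : partition b [set: 'I_n]) (rb : #|b| = r).

Lemma pblock_in x : pblock b x \in b.
Proof. by apply: pblock_mem; rewrite (cover_partition pb) inE. Qed.

Lemma val_ker_coord x : val (ker_coord b x) = index (pblock b x) (enum b).
Proof.
have lt : index (pblock b x) (enum b) < r.
  by rewrite -rb cardE index_mem mem_enum pblock_in.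
by rewrite val_insubd lt.
Qed.

Lemma ker_coord_eq x y :
  (ker_coord b x == ker_coord b y) = (pblock b x == pblock b y).
Proof.
apply/eqP/eqP => [/(congr1 val)|e]; last by rewrite /ker_coord e.
rewrite !val_ker_coord => e; have := pblock_in x; rewrite -mem_enum.
by move/(nth_index set0) => <-; rewrite e nth_index // mem_enum pblock_in.
Qed.

Lemma ker_coord_onto i : exists x, ker_coord b x = i.
Proof.
have lti : i < size (enum b) by rewrite -cardE rb.
have Cb : nth set0 (enum b) i \in b by rewrite -mem_enum mem_nth.
have [x Cx] := set0Pn _ (partition_neq0 pb Cb).
exists x; apply: val_inj; rewrite val_ker_coord (def_pblock _ Cb Cx).
  by rewrite index_uniq ?enum_uniq.
exact: partition_trivIset pb.
Qed.

(** With [r] elements and [r] classes, meeting no class twice amounts to meeting each class exactly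
    once. *)
Lemma transversalP a : #|a| = r -> reflect
  (injective (fun i => ker_coord b (img_coord a i)))
  (transv a b).
Proof.
move=> ra; have tb := partition_trivIset pb.
have mem_b x : x \in pblock b x by rewrite mem_pblock (cover_partition pb) inE.
rewrite /transv /is_transversal pb subsetT /=.
apply: (iffP forall_inP) => [one i j /eqP|inj C Cb].
  rewrite ker_coord_eq => /eqP eb; apply: (img_coord_inj ra).
  have /cards1P[z az] := one _ (pblock_in (img_coord a i)).
  have := mem_b (img_coord a j); rewrite -eb => bj.
  have : img_coord a i \in a :&: pblock b (img_coord a i).
    by rewrite inE img_coord_in // mem_b.
  have : img_coord a j \in a :&: pblock b (img_coord a i).
    by rewrite inE img_coord_in // bj.
  by rewrite az !inE => /eqP-> /eqP->.
have [x Cx] := set0Pn _ (partition_neq0 pb Cb).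
have [j _ ij] := injF_bij inj; pose i := j (ker_coord b x).
have /eqP := ij (ker_coord b x).
rewrite -/i ker_coord_eq (def_pblock tb Cb Cx) => /eqP iC.
apply/cards1P; exists (img_coord a i); apply/setP=> y; rewrite !inE.
apply/andP/eqP => [[/(img_coord_onto ra)[k <-] Cy]|->]; last first.
  by rewrite img_coord_in // -iC mem_b.
congr img_coord; apply: inj; apply/eqP.
by rewrite ker_coord_eq iC (def_pblock tb Cb Cy).
Qed.

Lemma transf_kerP (f : transf n) :
  (forall x y, (f x == f y) = (pblock b x == pblock b y)) <-> transf_ker f = b.
Proof.
split=> [fb|fb x y].
  rewrite -[RHS](preim_partition_pblock pb); apply: eq_in_imset => x _.
  by apply/setP=> y; rewrite !inE /= fb.
have tb := partition_trivIset pb.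
rewrite eq_pblock ?(cover_partition pb) ?inE // -fb.
rewrite pblock_equivalence_partition ?inE //.
by split=> // /eqP->.
Qed.

End Partition.

(** The sandwich matrix: the permutation by which a transversal [a] numbers the classes of [b], with
    the default [1] if there is none. *)
Definition link a b : 'S_r :=
  odflt 1%g [pick s : 'S_r | [forall i, s i == ker_coord b (img_coord a i)]].

Lemma linkE a b i : injective (fun i => ker_coord b (img_coord a i)) ->
  link a b i = ker_coord b (img_coord a i).
Proof.
move=> inj; rewrite /link; case: pickP => [s /forallP/(_ i)/eqP //|].
by move/(_ (perm inj))/negP; case; apply/forallP=> j; rewrite permE.
Qed.

Definition of_coord (t : {set {set 'I_n}} * 'S_r * {set 'I_n}) : transf n :=
  [ffun x => img_coord t.2 (t.1.2 (ker_coord t.1.1 x))].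

Variables (A : {set {set 'I_n}}) (B : {set {set {set 'I_n}}}).
Hypotheses (hA : forall a : {set 'I_n}, a \in A -> #|a| = r)
  (hB : forall b : {set {set 'I_n}},
        b \in B -> partition b [set: 'I_n] /\ #|b| = r).

Local Notation E := (@transv n).
Local Notation arr := (arrows 'S_r A B).

Definition top_maps := [set f : transf n | transf_im f \in A & transf_ker f \in B].

Lemma of_coord_im t : t \in arr -> transf_im (of_coord t) = t.2.
Proof.
case: t => [[b s] a]; rewrite inE => /andP[/= /hB[pb rb] /hA ra].
apply/setP=> y; apply/imsetP/idP => [[x _ ->]|/(img_coord_onto ra)[i <-]].
  by rewrite ffunE img_coord_in.
have [x xi] := ker_coord_onto pb rb (s^-1%g i).
by exists x; rewrite ?inE // ffunE /= xi permKV.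
Qed.

Lemma of_coord_ker t : t \in arr -> transf_ker (of_coord t) = t.1.1.
Proof.
case: t => [[b s] a]; rewrite inE => /andP[/= /hB[pb rb] /hA ra].
apply/(transf_kerP pb) => x y; rewrite !ffunE /= -(ker_coord_eq pb rb).
by rewrite (inj_eq (img_coord_inj ra)) (inj_eq perm_inj).
Qed.

Lemma of_coord_top t : t \in arr -> of_coord t \in top_maps.
Proof.
move=> ht; rewrite inE of_coord_im // of_coord_ker //.
by move: ht; rewrite inE andbC.
Qed.

Lemma of_coord_inj : {in arr &, injective of_coord}.
Proof.
move=> t t' ht ht' tt'.
have := of_coord_im ht; have := of_coord_ker ht.
rewrite tt' of_coord_im // of_coord_ker //.
case: t t' ht ht' tt' => [[b s] a] [[b' s'] a'] ht _ + /= ? ?; subst b' a'.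
move: ht; rewrite inE => /andP[/= /hB[pb rb] /hA ra] /ffunP tt'.
congr (_, _, _); apply/permP=> i; have [x <-] := ker_coord_onto pb rb i.
by have := tt' x; rewrite !ffunE /= => /(img_coord_inj ra).
Qed.

Lemma of_coord_onto f : f \in top_maps -> exists2 t, t \in arr & f = of_coord t.
Proof.
rewrite inE; set a := transf_im f; set b := transf_ker f => /andP[Aa Bb].
have [[pb rb] ra] := (hB Bb, hA Aa).
have fk x y : (f x == f y) = (ker_coord b x == ker_coord b y).
  by rewrite ker_coord_eq //; move: x y; apply/(transf_kerP pb).
have fa x : exists i, img_coord a i == f x.
  have /(img_coord_onto ra)[i <-] : f x \in a by apply: imset_f; rewrite inE.
  by exists i.
have kb i : exists x, ker_coord b x == i.
  by have [x <-] := ker_coord_onto pb rb i; exists x.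
(* The image coordinate of the value of [f] on the class numbered [i], computed at a chosen point of
   that class. *)
pose s i := xchoose (fa (xchoose (kb i))).
have sP x : img_coord a (s (ker_coord b x)) = f x.
  rewrite (eqP (xchooseP (fa _))); apply/eqP; rewrite fk.
  exact: (xchooseP (kb (ker_coord b x))).
have s_inj : injective s.
  move=> i j; have [x <-] := ker_coord_onto pb rb i.
  have [y <-] := ker_coord_onto pb rb j => sxy; apply/eqP; rewrite -fk.
  by apply/eqP; have := sP x; rewrite sxy => <-; apply: sP.
exists (b, perm s_inj, a); first by rewrite inE Aa Bb.
by apply/ffunP=> x; rewrite ffunE /= permE sP.
Qed.

Lemma of_coord_comp b s a b' s' a' : a \in A -> b' \in B -> E a b' ->
  transf_comp (of_coord (b, s, a)) (of_coord (b', s', a')) =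
  of_coord (b, s * link a b' * s', a')%g.
Proof.
move=> /hA ra /hB[pb rb] /(transversalP pb rb ra) inj.
by apply/ffunP=> x; rewrite !ffunE /= !permM linkE.
Qed.

(** The composite takes at most as many values as there are classes of [b'] met by [a], and some
    class is missed. *)
Lemma rank_of_coord_comp b s a b' s' a' : a \in A -> b' \in B -> ~~ E a b' ->
  #|transf_im (transf_comp (of_coord (b, s, a)) (of_coord (b', s', a')))| < r.
Proof.
move=> /hA ra /hB[pb rb] /(transversalP pb rb ra) ninj.
have le_f : #|transf_im (transf_comp (of_coord (b, s, a)) (of_coord (b', s', a')))|
    <= #|[set ker_coord b' (img_coord a i) | i : 'I_r]|.
  apply: (leq_card_onto (f := fun j => img_coord a' (s' j))) => y /imsetP[x _ ->].
  by rewrite !ffunE /=; eexists; last by []; apply: imset_f.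
apply: leq_ltn_trans le_f _; rewrite ltnNge; apply/negP => ge_r; apply: ninj.
have /imset_injP inj :
    #|[set ker_coord b' (img_coord a i) | i in [set: 'I_r]]| == #|[set: 'I_r]|.
  by rewrite eqn_leq leq_imset_card cardsT card_ord /=; apply: leq_trans ge_r _;
     apply/subset_leq_card/subsetP=> _ /imsetP[i _ ->]; apply: imset_f; rewrite inE.
by move=> i j; apply: inj; rewrite inE.
Qed.

(** * Generated subsemigroups and the transfer to arrows *)

Lemma rank_comp (f g : transf n) :
  (#|transf_im (transf_comp f g)| <= #|transf_im f|) &&
  (#|transf_im (transf_comp f g)| <= #|transf_im g|).
Proof.
apply/andP; split.
  apply: (leq_card_onto (f := g)) => y /imsetP[x _ ->].
  by exists (f x); rewrite ?ffunE // imset_f ?inE.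
apply/subset_leq_card/subsetP => y /imsetP[x _ ->].
by rewrite ffunE imset_f ?inE.
Qed.

Lemma subsemigroupP (S : {set transf n}) :
  reflect {in S &, forall f g, transf_comp f g \in S} (subsemigroup S).
Proof.
apply: (iffP forall_inP) => [cS f g Sf Sg|cS f Sf].
  exact: (forall_inP (cS f Sf)).
by apply/forall_inP => g; apply: cS.
Qed.

Lemma sub_semigroup_gen (X : {set transf n}) : X \subset semigroup_gen X.
Proof. by apply/bigcapsP => S /andP[]. Qed.

Lemma semigroup_gen_min (X S : {set transf n}) :
  subsemigroup S -> X \subset S -> semigroup_gen X \subset S.
Proof. by move=> cS sXS; apply: bigcap_inf; rewrite cS. Qed.

Lemma subsemigroup_gen (X : {set transf n}) : subsemigroup (semigroup_gen X).
Proof.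
apply/subsemigroupP => f g Xf Xg; apply/bigcapP => S hS.
have /andP[/subsemigroupP cS _] := hS.
by apply: cS; [move/bigcapP: Xf; apply | move/bigcapP: Xg; apply].
Qed.

Lemma semigroup_gen_id (S : {set transf n}) :
  subsemigroup S -> semigroup_gen S = S.
Proof.
by move=> cS; apply/eqP; rewrite eqEsubset semigroup_gen_min ?sub_semigroup_gen.
Qed.

(* A composite of rank [r] has factors of rank [r], so the maps of rank less
   than [r] can be added to any set of maps closed under products of rank [r]. *)
Lemma subsemigroup_low (P : {set {set {set 'I_n}} * 'S_r * {set 'I_n}}) :
  P \subset arr ->
  (forall b s a b' s' a', (b, s, a) \in P -> (b', s', a') \in P -> E a b' ->
     (b, s * link a b' * s', a')%g \in P) ->
  subsemigroup ([set f : transf n | #|transf_im f| < r] :|: of_coord @: P).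
Proof.
move=> /subsetP sP cP; apply/subsemigroupP => f g.
have /andP[lef leg] := rank_comp f g.
case/setUP=> [|Pf]; first by rewrite !inE => ltf _; rewrite (leq_ltn_trans lef).
case/setUP=> [|Pg]; first by rewrite !inE => ltg; rewrite (leq_ltn_trans leg).
case/imsetP: Pf Pg {lef leg} => -[[b s] a] Pt -> /imsetP[[[b' s'] a'] Pt' ->].
have [Bb' Aa] : b' \in B /\ a \in A.
  by have := sP _ Pt; have := sP _ Pt'; rewrite !inE => /andP[-> _] /andP[_ ->].
rewrite in_setU; case: (boolP (E a b')) => Eab.
  by rewrite of_coord_comp // imset_f ?orbT // cP.
by rewrite inE rank_of_coord_comp.
Qed.

Local Notation generates := (generates E link A B).

Lemma generates_card X :
  generates X -> exists2 Y, semigroup_gen Y == SAB A B & #|Y| <= #|X|.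
Proof.
move=> [sX genX]; exists (of_coord @: X); last exact: leq_imset_card.
have sXT : of_coord @: X \subset top_maps.
  by apply/subsetP=> _ /imsetP[t Xt ->]; apply/of_coord_top/(subsetP sX).
rewrite eqEsubset semigroup_gen_min ?subsemigroup_gen //=; last first.
  exact: subset_trans (sub_semigroup_gen _).
apply: semigroup_gen_min; first exact: subsemigroup_gen.
apply/subsetP=> f /of_coord_onto[[[b s] a] + ->]; rewrite inE => /andP[/= Bb Aa].
have [l w] := genX b s a Bb Aa.
elim: w {Bb Aa}=> [{}b {}s {}a Xt|{}l {}b {}s {}a b' s' a' Xt Eab w IH].
  by apply: (subsetP (sub_semigroup_gen _)); apply: imset_f.
have /andP[Bb' _] := walk_arrows sX w.
have := subsetP sX _ Xt; rewrite inE => /andP[_ /= Aa1].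
rewrite -of_coord_comp //; apply: (subsemigroupP _ (subsemigroup_gen _)) => //.
by apply: (subsetP (sub_semigroup_gen _)); apply: imset_f.
Qed.

(** Only the members of [Y] of rank [r] are kept, as triples. The others have smaller rank and
    cannot be factors of a product of rank [r]. *)
Lemma card_generates (Y : {set transf n}) :
  semigroup_gen Y = SAB A B -> exists2 X, generates X & #|X| <= #|Y|.
Proof.
move=> genY; pose X := [set t in arr | of_coord t \in Y].
have sX : X \subset arr by apply/subsetP=> t /setIdP[].
exists X; last first.
  have <- : #|of_coord @: X| = #|X|.
    by apply: card_in_imset => t t' /setIdP[ht _] /setIdP[ht' _]; apply: of_coord_inj.
  by apply/subset_leq_card/subsetP=> _ /imsetP[t /setIdP[_ Yt] ->].
pose low := [set f : transf n | #|transf_im f| < r].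
have low_top f : f \in low -> f \in top_maps -> False.
  by rewrite /low !inE => lt /andP[/hA rf _]; rewrite rf ltnn in lt.
have sT : SAB A B \subset low :|: top_maps.
  have -> : top_maps = of_coord @: arr.
    apply/setP=> f; apply/idP/imsetP=> [/of_coord_onto//|[t ht ->]].
    exact: of_coord_top.
  apply: semigroup_gen_min.
    apply: subsemigroup_low => // b s a b' s' a'.
    by rewrite !inE => /andP[-> _] /andP[_ ->].
  apply/subsetP=> f /of_coord_onto[t ht ->].
  by apply/setUP; right; apply: imset_f.
have sC : walk_closure E link X \subset arr.
  apply/subsetP=> -[[b s] a] /walk_closure_reach[l /(walk_arrows sX)].
  by rewrite inE.
(* The right-hand side is a subsemigroup containing [Y], so every map of rank [r] in [SAB A B] is
   spelled by a walk in [X]. *)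
have sY : SAB A B \subset low :|: of_coord @: walk_closure E link X.
  rewrite -genY; apply: semigroup_gen_min.
    apply: subsemigroup_low => // b s a b' s' a' Ct Ct' Eab.
    exact: (walk_closure_mul Ct Ct' Eab).
  apply/subsetP=> f Yf; have : f \in SAB A B.
    by rewrite -genY (subsetP (sub_semigroup_gen _)).
  move/(subsetP sT)/setUP=> [lf|/of_coord_onto[t ht ft]]; apply/setUP; [by left|right].
  rewrite ft; apply: imset_f; apply: (subsetP (sub_walk_closure _ _ _)).
  by rewrite inE ht -ft.
split=> // b s a Bb Aa; apply: walk_closure_reach.
have ht : (b, s, a) \in arr by rewrite inE Bb.
have : of_coord (b, s, a) \in SAB A B.
  by apply: (subsetP (sub_semigroup_gen _)); apply: of_coord_top.
move/(subsetP sY)/setUP=> [/low_top/(_ (of_coord_top ht)) //|/imsetP[t Ct]].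
by move/of_coord_inj => ->//; apply: (subsetP sC).
Qed.

Lemma semigroup_rank_SAB N :
  least_gen E link A B N -> semigroup_rank (SAB A B) = N.
Proof.
move=> [[X gX leX] lower]; rewrite /semigroup_rank.
(* The minimum in [semigroup_rank] is over a predicate that holds at its default element. *)
have genS : semigroup_gen (SAB A B) == SAB A B.
  by rewrite semigroup_gen_id ?subsemigroup_gen.
case: arg_minnP => // Y /eqP gY minY; apply/eqP; rewrite eqn_leq; apply/andP; split.
  have [Z gZ leZ] := generates_card gX.
  exact: leq_trans (minY _ gZ) (leq_trans leZ leX).
by have [Z gZ leZ] := card_generates gY; apply: leq_trans (lower _ gZ) leZ.
Qed.

End Coordinates.

(** * Degrees in the transversal graph *)

Section TransversalDegrees.

Variables (n : nat) (A : {set {set 'I_n}}) (B : {set {set {set 'I_n}}}).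

Local Notation E := (@transv n).

Lemma deg_inl a : a \in A -> deg A B (inl a) = #|[set b in B | E a b]|.
Proof.
move=> Aa; rewrite -(card_imset _ (@inr_inj {set 'I_n} _)); apply: eq_card => y.
rewrite inE; apply/andP/imsetP => [[]|[b /setIdP[Bb Eab] ->]].
  case: y => [a'|b] //= _ /and3P[_ Bb Eab]; exists b => //; by rewrite inE Bb.
split; last by rewrite /= Aa Bb.
by rewrite inE; apply/orP; right; apply: imset_f.
Qed.

Lemma deg_inr b : b \in B -> deg A B (inr b) = #|[set a in A | E a b]|.
Proof.
move=> Bb; rewrite -(card_imset _ (@inl_inj _ {set {set 'I_n}})); apply: eq_card => y.
rewrite inE; apply/andP/imsetP => [[]|[a /setIdP[Aa Eab] ->]].
  case: y => [a|b'] //= _ /and3P[Aa _ Eab]; exists a => //; by rewrite inE Aa.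
split; last by rewrite /= Aa Bb.
by rewrite inE; apply/orP; left; apply: imset_f.
Qed.

Lemma deg_inl_gt0 a : a \in A -> (0 < deg A B (inl a)) = (a \in Apos E A B).
Proof.
move=> Aa; rewrite deg_inl // card_gt0; apply/set0Pn/AposP.
  by move=> [b /setIdP[Bb Eab]]; split=> //; exists b.
by move=> [_ [b Bb Eab]]; exists b; rewrite inE Bb.
Qed.

Lemma deg_inr_gt0 b : b \in B -> (0 < deg A B (inr b)) = (b \in Bpos E A B).
Proof.
move=> Bb; rewrite deg_inr // card_gt0; apply/set0Pn/BposP.
  by move=> [a /setIdP[Aa Eab]]; split=> //; exists a.
by move=> [_ [a Aa Eab]]; exists a; rewrite inE Aa.
Qed.

Lemma vplus_vertA : vplus A B (vertA A) = #|Apos E A B|.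
Proof.
rewrite -(card_imset _ (@inl_inj _ {set {set 'I_n}})); apply: eq_card => y.
rewrite inE; apply/andP/imsetP => [[/imsetP[a Aa ->]]|[a Aa ->]].
  by rewrite deg_inl_gt0 // => Aa'; exists a.
by have [Aa' _] := AposP _ _ _ _ Aa; rewrite imset_f // deg_inl_gt0.
Qed.

Lemma vplus_vertB : vplus A B (vertB B) = #|Bpos E A B|.
Proof.
rewrite -(card_imset _ (@inr_inj {set 'I_n} _)); apply: eq_card => y.
rewrite inE; apply/andP/imsetP => [[/imsetP[a Aa ->]]|[a Aa ->]].
  by rewrite deg_inr_gt0 // => Aa'; exists a.
by have [Aa' _] := BposP _ _ _ _ Aa; rewrite imset_f // deg_inr_gt0.
Qed.

Lemma v0_vertAB :
  v0 A B (vertAB A B) = #|A :\: Apos E A B| + #|B :\: Bpos E A B|.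
Proof.
rewrite -(card_imset _ (@inl_inj _ {set {set 'I_n}})).
rewrite -(card_imset (B :\: _) (@inr_inj {set 'I_n} _)).
set S := [set inl _ | _ in _]; set T := [set inr _ | _ in _].
have dST : [disjoint S & T].
  by apply/pred0P=> y /=; apply/negP=> /andP[/imsetP[a _ ->] /imsetP[]].
have -> : #|S| + #|T| = #|S :|: T|.
  by apply/esym/eqP; rewrite (leq_card_setU S T).2.
apply: eq_card => y; rewrite !inE; apply/idP/orP => [/andP[/orP[]]|[]].
- case/imsetP=> a Aa ->; rewrite eqn0Ngt deg_inl_gt0 // => nA; left.
  by apply: imset_f; rewrite in_setD nA.
- case/imsetP=> b Bb ->; rewrite eqn0Ngt deg_inr_gt0 // => nB; right.
  by apply: imset_f; rewrite in_setD nB.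
- case/imsetP=> a /setDP[Aa nA] ->.
  by rewrite [inl a \in vertA A]imset_f // eqn0Ngt deg_inl_gt0 // nA.
- case/imsetP=> b /setDP[Bb nB] ->.
  by rewrite [inr b \in vertB B]imset_f // eqn0Ngt deg_inr_gt0 // nB orbT.
Qed.

Lemma deg_gt_edge k : k < max_deg A B ->
  (exists2 a, a \in A & k < #|[set b in B | E a b]|) \/
  (exists2 b, b \in B & k < #|[set a in A | E a b]|).
Proof.
move=> ltk; have /existsP[x /andP[xAB ltx]] :
    [exists x, (x \in vertAB A B) && (k < deg A B x)].
  apply: contraLR ltk; rewrite negb_exists -leqNgt => /forallP nx.
  by apply/bigmax_leqP => x xAB; have := nx x; rewrite xAB -leqNgt.
case/setUP: xAB ltx => /imsetP[z hz ->]; rewrite ?deg_inl ?deg_inr // => ltz.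
  by left; exists z.
by right; exists z.
Qed.

Lemma max_deg_inl a : a \in A -> #|[set b in B | E a b]| <= max_deg A B.
Proof.
by move=> Aa; rewrite -deg_inl //; apply: leq_bigmax_cond; rewrite inE imset_f.
Qed.

Lemma max_deg_inr b : b \in B -> #|[set a in A | E a b]| <= max_deg A B.
Proof.
move=> Bb; rewrite -deg_inr //; apply: leq_bigmax_cond.
by rewrite inE orbC imset_f.
Qed.

End TransversalDegrees.

(** * The symmetric group and the rank formula *)

Lemma sym_two_generated r :
  1 < r -> exists x y : 'S_r, [set: 'S_r] \subset <<[set x; y]>>%g.
Proof.
case: r => [|[|r]] // _.
(* A transposition and the full cycle, the latter as addition of [1] modulo [r.+2]. *)
exists (tperm (0%R : 'I_r.+2) 1%R), (perm (@GRing.addrI 'I_r.+2 1%R)).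
by rewrite gen_tpermn_circular_shift // GRing.subr0 coprimen1.
Qed.

Lemma sym_not_abelian r :
  2 < r -> exists g h : 'S_r, (g * h != h * g)%g.
Proof.
case: r => [|[|[|r]]] // _.
pose i0 := @Ordinal r.+3 0 isT; pose i1 := @Ordinal r.+3 1 isT.
pose i2 := @Ordinal r.+3 2 isT.
(* One product sends [i0] to [i2], the other sends it to [i1]. *)
exists (tperm i0 i1), (tperm i1 i2); apply/eqP => /permP/(_ i0).
by rewrite !permM tpermL tpermL (tpermD (z := i0)) // tpermL.
Qed.

Theorem theorem15 (n r : nat) (A : {set {set 'I_n}}) (B : {set {set {set 'I_n}}})
    (lt2r : 2 < r) (ltrn : r < n)
    (hA : forall a : {set 'I_n}, a \in A -> #|a| = r)
    (hB : forall b : {set {set 'I_n}},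
        b \in B -> partition b [set: 'I_n] /\ #|b| = r) :
  [/\ 2 <= max_deg A B ->
        semigroup_rank (SAB A B)
        = maxn (vplus A B (vertA A)) (vplus A B (vertB B)) + v0 A B (vertAB A B),
      max_deg A B = 1 ->
        semigroup_rank (SAB A B)
        = maxn (vplus A B (vertA A)) (vplus A B (vertB B))
          + v0 A B (vertAB A B) + 1
    & max_deg A B = 0 ->
        semigroup_rank (SAB A B) = #|A| * #|B| * r`!].
Proof.
have r_gt0 : 0 < r by apply: leq_trans lt2r.
pose i0 := Ordinal r_gt0; pose x0 := Ordinal (ltn_trans r_gt0 ltrn).
have rankE := @semigroup_rank_SAB n r x0 i0 A B hA hB.
have [x [y genG]] := sym_two_generated (ltnW lt2r).
rewrite vplus_vertA vplus_vertB v0_vertAB; split.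
(* A vertex of degree at least two, on either side, gives two edges with a common end. *)
- case/deg_gt_edge=> [[a Aa /card_gt1P]|[b Bb /card_gt1P]].
    case=> b [b' [/setIdP[Bb Eab] /setIdP[Bb' Eab'] nb]].
    apply: rankE; apply: (least_gen_path _ genG); exists a, b; split=> //.
    by right; exists b'; rewrite // Eab' eq_sym.
  case=> a [a' [/setIdP[Aa Eab] /setIdP[Aa' Eab'] na]].
  apply: rankE; apply: (least_gen_path _ genG); exists a, b; split=> //.
  by left; exists a'; rewrite // Eab' eq_sym.
- move=> deg1; apply: rankE.
  apply: (least_gen_matching _ genG (sym_not_abelian lt2r)).
  + have : 0 < max_deg A B by rewrite deg1.
    case/deg_gt_edge=> [[a Aa]|[b Bb]]; rewrite card_gt0 => /set0Pn[z /setIdP[hz Ez]].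
      by exists a, z.
    by exists z, b.
  + move=> a b b' Aa Bb Bb' Eab Eab'.
    have := max_deg_inl B Aa; rewrite deg1 => /card_le1_eqP.
    by apply; rewrite inE ?Bb ?Bb'.
  + move=> a a' b Aa Aa' Bb Eab Ea'b.
    have := max_deg_inr A Bb; rewrite deg1 => /card_le1_eqP.
    by apply; rewrite inE ?Aa ?Aa'.
- move=> deg0; rewrite -card_Sn; apply: rankE; apply: least_gen_no_edge => a b Aa Bb.
  have := max_deg_inl B Aa; rewrite deg0 leqn0 cards_eq0 => /eqP/setP/(_ b).
  by rewrite !inE Bb /= => ->.
Qed.
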